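(* Let $k\geq 3$ be an integer. For infinitely many values of $n\in\mathbb{N}$, there exists a $k$-dicritical oriented graph on $n$ vertices with at most $\left(2k-\frac72\right)n$ arcs.
   Context: Digraphs are finite, without loops or parallel arcs, but two opposite arcs between the same two vertices are allowed; such a pair is called a digon. An oriented graph is a digraph with no digon. A $k$-dicolouring of a digraph $D$ is a function $\phi:V(D)\to\{1,\dots,k\}$ such that no directed cycle of $D$ is monochromatic (a digon is a directed cycle of length $2$). The dichromatic number $\vec{\chi}(D)$ is the smallest $k$ such that $D$ has a $k$-dicolouring. $D$ is $k$-dicritical if $\vec{\chi}(D)=k$ and $\vec{\chi}(H)<k$ for every proper subdigraph $H$ of $D$. *)

(* Defs.v *)
From mathcomp Require Import all_boot all_order all_algebra.
From mathcomp Require Import boolp.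

Set Implicit Arguments.
Unset Strict Implicit.
Unset Printing Implicit Defensive.

(* The vertex set is a subset of an ambient finite type, so that a subdigraph
   is a digraph over the same type with fewer vertices and arcs.  The
   well-formedness field is boolean, hence proof-irrelevant, and Leibniz
   equality of digraphs is equality of the vertex and arc sets. *)
Record digraph (T : finType) := Digraph {
  verts : {set T};
  arcs : {set T * T};
  arcs_wf :
    arcs \subset [set a | [&& a.1 \in verts, a.2 \in verts & a.1 != a.2]]
}.

Section DigraphTheory.
Variable T : finType.
Implicit Types (D H : digraph T) (c : seq T) (phi : T -> nat) (k : nat).

Definition arc D : rel T := [rel u v | (u, v) \in arcs D].

Definition oriented D : Prop := forall u v, ~~ (arc D u v && arc D v u).

(* The cycle [:: v_1; ...; v_m] has the arcs v_i -> v_{i+1} and v_m -> v_1;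
   a digon is the case m = 2, and m = 1 is excluded by looplessness. *)
Definition dicycle D c : bool := [&& c != [::], uniq c & cycle (arc D) c].

(* Only the values of phi on verts D matter. *)
Definition dicolouring D k phi : Prop :=
  (forall v, v \in verts D -> 1 <= phi v <= k) /\
  (forall c, dicycle D c -> ~~ constant [seq phi v | v <- c]).

Definition dicolourable D k : Prop := exists phi, dicolouring D k phi.

Lemma arc_irr D u : arc D u u = false.
Proof.
apply/negP => /(subsetP (arcs_wf D)).
by rewrite inE /= eqxx !andbF.
Qed.

Lemma dicolourable_ex D : exists k, `[< dicolourable D k >].
Proof.
exists #|T|; apply/asboolP; exists (fun v => (enum_rank v).+1).
split=> [v _|c]; first by rewrite /= ltn_ord.
case: c => [|x [|y c]] //; first by rewrite /dicycle /= arc_irr.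
case/and3P=> _ /= /andP[+ _] _; rewrite inE negb_or => /andP[nxy _].
apply/negP => /andP[/eqP[/val_inj/enum_rank_inj exy] _].
by rewrite exy eqxx in nxy.
Qed.

Definition dichromatic_number D : nat := ex_minn (dicolourable_ex D).

Definition subdigraph H D : Prop :=
  (verts H \subset verts D) /\ (arcs H \subset arcs D).

Definition proper_subdigraph H D : Prop := subdigraph H D /\ H <> D.

Definition dicritical k D : Prop :=
  dichromatic_number D = k /\
  forall H, proper_subdigraph H D -> dichromatic_number H < k.

End DigraphTheory.

(* Main.v *)
Require Import Defs.
From mathcomp Require Import all_boot all_order all_algebra.
From mathcomp Require Import boolp zify lra.
Import Order.TTheory GRing.Theory Num.Theory.
(* The digraph predicate arc would otherwise denote the sub-arc of a cyclic
   sequence. *)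
Import Defs.

Set Implicit Arguments.
Unset Strict Implicit.
Unset Printing Implicit Defensive.

(** The graphs are built by gluing.  Let G be an undirected graph that is not
    properly q-colourable but becomes so, with exactly the ends of e receiving
    equal colours, once any single edge e is deleted.  Orient G, let D be a
    q-dicritical oriented graph, and replace each edge a -> b of G by the arc
    b -> a together with a private copy of D, called a block, all of whose
    vertices have an arc from a and an arc to b.

    If q colours are used and a, b have the same colour z, then z is absent
    from the block, since a vertex s of colour z would close the triangle
    a -> s -> b -> a; so the block is coloured with q - 1 colours, which D does
    not allow.  Hence a q-dicolouring would colour G properly, and there is
    none ([glue_ndicolourable]).  Conversely, once an arc is deleted at the
    place of the edge e, colour G so that only e has equal ends, of colour z.
    The block of e can be coloured so that no monochromatic path goes round
    the triangle any more: keep D coloured with all q colours if b -> a is the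
    missing arc, give z to the single vertex of the block whose arc to a or b
    is missing, and avoid z altogether if the missing arc is inside the block.
    No other edge of G carries a monochromatic path from end to end, so no
    monochromatic cycle survives ([glue_acyclic]).  Thus gluing yields a
    (q+1)-dicritical oriented graph ([glue_dicritical]).

    With |E| edges in G, this graph has |G| + |E| |D| vertices and
    |E| (1 + 2 |D| + |A(D)|) arcs.  So 2 arcs are paid per block vertex on top
    of the arcs of D, which is the growth of 2k - 7/2 when k increases by one,
    and the constants work out:
    - a single vertex is 1-dicritical, and gluing it along one edge gives the
      directed triangle, which is 2-dicritical ([triangle_exists]);
    - gluing the triangle along an odd cycle of length l gives 4l vertices and
      10l arcs, the ratio 5/2 needed for k = 3 ([sparse_critical3]);
    - gluing arbitrarily large sparse k-dicritical graphs along the complete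
      graph on k+1 vertices gives sparse (k+1)-dicritical ones
      ([sparse_criticalS]). *)

(** * Dicolourings and acyclic colour classes *)

Definition acyclic (T : eqType) (R : rel T) : Prop :=
  forall c, c != [::] -> uniq c -> ~~ cycle R c.

Definition mono (T : finType) (D : digraph T) (phi : T -> nat) : rel T :=
  [rel u v | arc D u v && (phi u == phi v)].

(** Walking once around a cycle, a transitive relation that holds along every
    arc holds between any two vertices, in both directions.  With <= on ranks
    it makes the rank constant, with equality it makes colours constant. *)
Lemma cycle_homo (T : eqType) (R : rel T) (L : rel T) (c : seq T) :
  transitive L -> subrel R L -> cycle R c -> {in c &, forall x y, L x y}.
Proof.
move=> trL subRL /(sub_cycle subRL); rewrite cycle_all2rel //.
by move/allrelP.
Qed.

Lemma acyclic_eq0 (T : eqType) (R : rel T) :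
  (forall x y, ~~ R x y) -> acyclic R.
Proof.
by move=> R0 [//|x [|y c]] _ _ /=; rewrite (negPf (R0 _ _)).
Qed.

Section Colourings.
Variable T : finType.
Implicit Types (D H : digraph T) (phi : T -> nat) (k q : nat).

Lemma constant_cycle D phi c :
  dicycle D c -> constant [seq phi v | v <- c] -> cycle (mono D phi) c.
Proof.
case/and3P=> _ _ cyc const.
suff cyc' : cycle (relpre phi eq_op) c.
  by rewrite (cycle_relI (arc D) (relpre phi eq_op)); apply/andP.
have tr : transitive (relpre phi eq_op) by move=> y x z /= /eqP-> /eqP->.
rewrite cycle_all2rel //; apply/allrelP => x y xc yc.
move: const (map_f phi xc) (map_f phi yc).
case: [seq _ | _ <- _] => //= z s /allP all_z; rewrite !inE.
have zE t : (t == z) || (t \in s) -> t = z.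
  by case/orP => [/eqP//|/all_z/eqP].
by move=> /zE-> /zE->.
Qed.

(** A monochromatic dicycle is the same thing as a cycle of the relation that
    keeps only the arcs with equally coloured ends, and the latter is a local
    condition, stable under restricting, relabelling and deleting arcs. *)
Lemma dicolouringP D k phi :
  dicolouring D k phi <->
  (forall v, v \in verts D -> 1 <= phi v <= k) /\ acyclic (mono D phi).
Proof.
split=> -[rng nomono]; split=> // c.
- move=> c0 Uc; apply/negP=> cyc.
  have dc : dicycle D c.
    by rewrite /dicycle c0 Uc; apply: sub_cycle cyc => x y /andP[].
  have eq_c : {in c &, forall x y, phi x == phi y}.
    apply: cycle_homo cyc; last by move=> x y /andP[].
    by move=> y x z /= /eqP-> /eqP->.
  have := nomono c dc; case: c c0 {Uc cyc dc} eq_c => //= x c _ eq_c.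
  case/negP; apply/allP => _ /mapP[y yc ->] /=.
  by apply: eq_c; rewrite inE ?eqxx ?yc ?orbT.
- move=> dc; apply/negP => /(constant_cycle dc).
  by case/and3P: dc => c0 Uc _; apply/negP/nomono.
Qed.

Lemma dicolourableW D k k' : k <= k' -> dicolourable D k -> dicolourable D k'.
Proof.
move=> le_k [phi [rng nomono]]; exists phi; split=> // v /rng /andP[-> /=].
by move/leq_trans; apply.
Qed.

Lemma sub_dicolourable H D k :
  subdigraph H D -> dicolourable D k -> dicolourable H k.
Proof.
move=> [/subsetP sV /subsetP sA] [phi [rng nomono]]; exists phi.
split=> [v /sV/rng //|c /and3P[c0 Uc cyc]]; apply: nomono.
by rewrite /dicycle c0 Uc; apply: sub_cycle cyc => x y /sA.
Qed.

Lemma dichromatic_leP D k :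
  reflect (dicolourable D k) (dichromatic_number D <= k).
Proof.
rewrite /dichromatic_number; case: ex_minnP => m /asboolP col_m min_m.
apply: (iffP idP) => [le_mk|col_k]; first exact: dicolourableW le_mk col_m.
by apply: min_m; apply/asboolP.
Qed.

Fact del_arc_wf D f : arcs D :\ f
  \subset [set a | [&& a.1 \in verts D, a.2 \in verts D & a.1 != a.2]].
Proof. exact: subset_trans (subsetDl _ _) (arcs_wf D). Qed.

Definition del_arc D f := Digraph (del_arc_wf D f).

Fact del_vertex_wf D s : [set a in arcs D | (a.1 != s) && (a.2 != s)]
  \subset [set a | [&& a.1 \in verts D :\ s, a.2 \in verts D :\ s
                     & a.1 != a.2]].
Proof.
apply/subsetP => a; rewrite inE => /and3P[/(subsetP (arcs_wf D))].
by rewrite !inE => /and3P[-> -> ->] -> ->.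
Qed.

Definition del_vertex D s := Digraph (del_vertex_wf D s).

Lemma arc_verts D u v : arc D u v -> (u \in verts D) /\ (v \in verts D).
Proof. by move/(subsetP (arcs_wf D)); rewrite inE => /and3P[]. Qed.

Lemma del_arc_proper D f : f \in arcs D -> proper_subdigraph (del_arc D f) D.
Proof.
move=> fD; split; first by split; rewrite /= ?subsetDl.
by move=> eqD; move: fD; rewrite -eqD /= !inE eqxx.
Qed.

Lemma del_vertex_proper D s :
  s \in verts D -> proper_subdigraph (del_vertex D s) D.
Proof.
move=> sD; split; last by move=> eqD; move: sD; rewrite -eqD /= !inE eqxx.
split; rewrite /= ?subsetDl //.
by apply/subsetP => a; rewrite inE => /andP[].
Qed.

Lemma digraph_eq D H : verts D = verts H -> arcs D = arcs H -> D = H.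
Proof.
case: D H => [V A wf] [V' A' wf'] /= eV eA; subst.
by congr Digraph; apply: bool_irrelevance.
Qed.

(** It suffices to test the deletions of a single arc: without isolated
    vertices, every proper subdigraph misses an arc.  The upper bound on the
    dichromatic number also comes from such a deletion, by giving a fresh
    colour to one end of the missing arc. *)
Lemma dicritical_intro D q v0 :
    v0 \in verts D ->
    (forall v, v \in verts D -> exists w, arc D v w || arc D w v) ->
    ~ dicolourable D q ->
    (forall f, f \in arcs D -> dicolourable (del_arc D f) q) ->
  dicritical q.+1 D.
Proof.
move=> v0D no_iso ncol col_del; split; last first.
  move=> H [[sV sA] neHD]; rewrite ltnS; apply/dichromatic_leP.
  have [sAH|/subsetPn[f fD fH]] := boolP (arcs D \subset arcs H).
    case: neHD; apply: digraph_eq; apply/eqP; rewrite eqEsubset ?sV ?sA //=.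
    apply/subsetP => v /no_iso[w /orP[]] /(subsetP sAH) aH.
      by have [] := @arc_verts H v w aH.
    by have [] := @arc_verts H w v aH.
  apply: sub_dicolourable (col_del f fD); split=> //=.
  apply/subsetP => a aH; rewrite !inE (subsetP sA) // andbT.
  by apply: contraNneq fH => <-.
apply/eqP; rewrite eqn_leq; apply/andP; split; last first.
  by rewrite ltnNge; apply/negP => /dichromatic_leP.
apply/dichromatic_leP.
have [f fD] : exists f, f \in arcs D.
  by have [w /orP[] a] := no_iso _ v0D; [exists (v0, w) | exists (w, v0)].
have [phi /dicolouringP[rng acyc]] := col_del f fD.
have [f1D _] : (f.1 \in verts D) /\ (f.2 \in verts D).
  by apply: arc_verts; rewrite /arc /= -surjective_pairing.
exists (fun v => if v == f.1 then q.+1 else phi v); apply/dicolouringP; split.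
  move=> v vD; case: eqP => //= _; have /andP[-> /=] := rng v vD.
  exact: leqW.
move=> c c0 Uc; apply/negP => cyc; case/negP: (acyc c c0 Uc).
apply: sub_cycle cyc => u v /= /andP[uv].
have [uD vD] := arc_verts uv.
have big w : w \in verts D -> (q.+1 == phi w) = false.
  by move/rng=> /andP[_]; rewrite -ltnS; case: ltngtP.
have [eu|nu] := eqVneq u f.1; have [ev|nv] := eqVneq v f.1.
- by move: uv; rewrite eu ev arc_irr.
- by rewrite big.
- by rewrite eq_sym big.
- rewrite /mono /= => ->; rewrite andbT /arc /= !inE.
  by apply/andP; split=> //; apply: contraNneq nu => <-.
Qed.

Lemma dicritical_dicolourable D q : dicritical q D -> dicolourable D q.
Proof. by move=> [eq _]; apply/dichromatic_leP; rewrite eq. Qed.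

Lemma dicritical_proper D H q :
  dicritical q.+1 D -> proper_subdigraph H D -> dicolourable H q.
Proof. by move=> [_ crit] /crit; rewrite ltnS => /dichromatic_leP. Qed.

Lemma dicritical_ndicolourable D q : dicritical q.+1 D -> ~ dicolourable D q.
Proof. by move=> [eq _] /dichromatic_leP; rewrite eq ltnn. Qed.

(** [bump z] renumbers the colours so as to skip z. *)
Lemma dicolouring_avoid D q z :
  dicolourable D q -> 0 < z <= q.+1 ->
  exists2 phi, dicolouring D q.+1 phi & forall v, phi v != z.
Proof.
move=> [phi /dicolouringP[rng acyc]] zP.
exists (bump z \o phi) => [|v]; last by rewrite eq_sym neq_bump.
apply/dicolouringP; split=> [v /rng /andP[v0 vq]|].
  by rewrite /= /bump addn_gt0 v0 orbT -addn1 addnC leq_add // leq_b1.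
move=> c c0 Uc; apply: contra (acyc c c0 Uc); apply: sub_cycle => u v /=.
by rewrite /mono /= (inj_eq (can_inj (bumpK z))).
Qed.

Lemma dicolouring_skip D q z phi :
  dicolouring D q.+1 phi -> 0 < z <= q.+1 ->
  (forall v, v \in verts D -> phi v != z) -> dicolourable D q.
Proof.
move=> /dicolouringP[rng acyc] /andP[z0 zq] avoid.
exists (unbump z \o phi); apply/dicolouringP; split=> [v vD|].
  have := avoid v vD; have /andP[v0 vq] := rng v vD; rewrite /= /unbump.
  by case: (ltngtP (phi v) z) => // lt _; rewrite ?subn0 ?subn1; lia.
move=> c c0 Uc; apply: contra (acyc c c0 Uc); apply: sub_cycle => u v /=.
rewrite /mono /= => /andP[uv /eqP]; rewrite uv /=; have [uD vD] := arc_verts uv.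
by move/(congr1 (bump z)); rewrite !unbumpK ?inE ?avoid // => ->.
Qed.

(** The deletion of s can be coloured without z, which is then free for s. *)
Lemma dicritical_lonely_colouring D q z s :
  dicritical q.+1 D -> s \in verts D -> 0 < z <= q.+1 ->
  exists phi,
    [/\ dicolouring D q.+1 phi, phi s = z & forall v, v != s -> phi v != z].
Proof.
move=> crit sD zq.
have [phi /dicolouringP[rng acyc] nz] :=
  dicolouring_avoid (dicritical_proper crit (del_vertex_proper sD)) zq.
exists (fun v => if v == s then z else phi v); split; last first.
- by move=> v /negPf->.
- by rewrite eqxx.
apply/dicolouringP; split=> [v vD|].
  by case: ifPn => // ns; apply: rng; rewrite !inE ns.
move=> c c0 Uc; apply: contra (acyc c c0 Uc); apply: sub_cycle => u v /=.
rewrite /mono /= => /andP[uv].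
have [eu|nu] := eqVneq u s; have [ev|nv] := eqVneq v s.
- by move: uv; rewrite eu ev arc_irr.
- by rewrite eq_sym (negPf (nz _)).
- by rewrite (negPf (nz _)).
- by move=> ->; rewrite /arc /= !inE /= nu nv !andbT.
Qed.

End Colourings.

(** * Gluing digraphs along a critical graph *)

(** An orientation [E] of a (q+1)-critical graph.  In a proper colouring with
    colours 1, ..., q of the graph without the edge e0, the ends of e0
    necessarily have equal colours. *)
Record critical_orientation (V : finType) (E : {set V * V}) (q : nat) : Prop :=
  CriticalOrientation {
    edge_asym : forall a b, (a, b) \in E -> (b, a) \notin E;
    edge_cover : forall a, exists b, ((a, b) \in E) || ((b, a) \in E);
    edge_ncol : forall g : V -> nat, (forall a, 0 < g a <= q) ->
      exists2 e, e \in E & g e.1 = g e.2;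
    edge_crit : forall e0, e0 \in E -> exists g : V -> nat,
      [/\ forall a, 0 < g a <= q, g e0.1 = g e0.2
        & forall e, e \in E -> e != e0 -> g e.1 != g e.2]
}.

Section Gluing.
Variables (V S : finType) (E : {set V * V}) (D : digraph S).
Hypothesis asymE : forall a b, (a, b) \in E -> (b, a) \notin E.

Notation gT := (V + (V * V) * S)%type.

(** [inl a] is a vertex of the graph and [inr (e, s)] the copy of the vertex s
    of D in the block of e. *)
Definition glue_arc : rel gT := fun x y =>
  match x, y with
  | inl b, inl a => (a, b) \in E
  | inl a, inr (e, s) => [&& e \in E, s \in verts D & a == e.1]
  | inr (e, s), inl b => [&& e \in E, s \in verts D & b == e.2]
  | inr (e, s), inr (e', s') => [&& e \in E, e == e' & arc D s s']
  end.

Definition glue_verts : {set gT} :=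
  [set x | if x is inr (e, s) then (e \in E) && (s \in verts D) else true].

Lemma edge_irr a : (a, a) \in E = false.
Proof. by apply/negP => aE; case/negP: (asymE aE). Qed.

Fact glue_wf : [set p | glue_arc p.1 p.2] \subset
  [set p | [&& p.1 \in glue_verts, p.2 \in glue_verts & p.1 != p.2]].
Proof.
apply/subsetP => -[x y]; rewrite !inE /=.
case: x y => [a|[e s]] [b|[e' s']] //=.
- by move=> baE; apply: contraTneq baE => -[->]; rewrite edge_irr.
- by case/and3P=> -> ->.
- by case/and3P=> -> ->.
- case/and3P=> eE /eqP<- st; rewrite eE /=; have [-> ->] := arc_verts st.
  by apply: contraTneq st => -[->]; rewrite arc_irr.
Qed.

Definition glue := Digraph glue_wf.

Lemma arc_glue x y : arc glue x y = glue_arc x y.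
Proof. by rewrite /arc /= inE. Qed.

Lemma glue_oriented : oriented D -> oriented glue.
Proof.
move=> orD x y; rewrite !arc_glue; apply/negP => /andP[].
case: x y => [a|[e s]] [b|[e' s']] //=.
- by move=> /asymE/negPf->.
- case/and3P=> eE _ /eqP-> /and3P[_ _ /eqP e12].
  by rewrite [e']surjective_pairing e12 edge_irr in eE.
- case/and3P=> eE _ /eqP-> /and3P[_ _ /eqP e12].
  by rewrite [e]surjective_pairing e12 edge_irr in eE.
- by case/and3P=> _ _ st /and3P[_ _ ts]; case/negP: (orD s s'); rewrite st.
Qed.

Lemma card_glue_verts : #|verts glue| = #|V| + #|E| * #|verts D|.
Proof.
have -> : verts glue = (inl @: [set: V]) :|: (inr @: setX E (verts D)).
  apply/setP => x; rewrite !inE; case: x => [a|[e s]].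
    by rewrite imset_f ?inE.
  rewrite [X in X || _](_ : _ = false); last by apply/negP => /imsetP[].
  by rewrite mem_imset ?inE // => ? ? [].
rewrite cardsU [X in _ - #|pred_of_set X|](_ : _ = set0); last first.
  apply/setP => x; rewrite !inE; apply/negP.
  by case/andP => /imsetP[a _ ->] /imsetP[].
by rewrite cards0 subn0 !card_imset ?cardsX ?cardsT //; move=> ? ? [].
Qed.

Lemma card_glue_arcs :
  #|arcs glue| <= #|E| * (1 + 2 * #|verts D| + #|arcs D|).
Proof.
pose A1 : {set gT * gT} := [set (inl e.2, inl e.1) | e in E].
pose A2 : {set gT * gT} := [set (inl p.1.1, inr p) | p in setX E (verts D)].
pose A3 : {set gT * gT} := [set (inr p, inl p.1.2) | p in setX E (verts D)].
pose A4 : {set gT * gT} :=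
  [set (inr (p.1, p.2.1), inr (p.1, p.2.2)) | p in setX E (arcs D)].
have sub : arcs glue \subset A1 :|: A2 :|: A3 :|: A4.
  apply/subsetP => -[x y]; rewrite -[_ \in _]/(arc glue x y) arc_glue.
  rewrite !in_setU -!orbA.
  case: x y => [b|[e s]] [a|[e' s']] /=.
  - by move=> abE; apply/or4P/Or41/imsetP; exists (a, b).
  - case/and3P=> eE sD /eqP->; apply/or4P/Or42/imsetP.
    by exists (e', s'); rewrite ?inE ?eE.
  - case/and3P=> eE sD /eqP->; apply/or4P/Or43/imsetP.
    by exists (e, s); rewrite ?inE ?eE.
  - case/and3P=> eE /eqP<- st; apply/or4P/Or44/imsetP.
    by exists (e, (s, s')); rewrite ?inE ?eE.
apply: leq_trans (subset_leq_card sub) _.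
have c1 : #|A1| <= #|E| by apply: leq_imset_card.
have c2 : #|A2| <= #|E| * #|verts D| by rewrite -cardsX leq_imset_card.
have c3 : #|A3| <= #|E| * #|verts D| by rewrite -cardsX leq_imset_card.
have c4 : #|A4| <= #|E| * #|arcs D| by rewrite -cardsX leq_imset_card.
have -> : #|E| * (1 + 2 * #|verts D| + #|arcs D|)
    = #|E| + #|E| * #|verts D| + #|E| * #|verts D| + #|E| * #|arcs D| by lia.
by do 3![apply: leq_trans (leq_card_setU _ _).1 _; apply: leq_add => //].
Qed.

(** Some edge e has ends of equal colour z.  A block vertex of colour z would
    close a monochromatic triangle with them, so the block of e gives a
    colouring of D that skips z. *)
Lemma glue_ndicolourable q :
    (forall g : V -> nat, (forall a, 0 < g a <= q.+1) ->
      exists2 e, e \in E & g e.1 = g e.2) ->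
  ~ dicolourable D q -> ~ dicolourable glue q.+1.
Proof.
move=> ncolE ncolD [phi /dicolouringP[rng acyc]].
have rngl a : 0 < phi (inl a) <= q.+1 by apply: rng; rewrite inE.
have [e eE /= eqe] := ncolE (phi \o inl) rngl.
pose h s := phi (inr (e, s)).
apply: ncolD; apply: (@dicolouring_skip _ D q (phi (inl e.1)) h) => //.
  apply/dicolouringP; split=> [s sD|c c0 Uc].
    by apply: rng; rewrite inE eE.
  have := acyc [seq inr (e, s) | s <- c].
  rewrite map_inj_uniq; last by move=> ? ? [].
  rewrite -size_eq0 size_map size_eq0 => /(_ c0 Uc); apply: contra.
  rewrite cycle_map; apply: sub_cycle => s t /andP[st] /=.
  by rewrite /mono /= arc_glue /= eE eqxx st.
move=> s sD; apply/eqP; rewrite /h => eqs.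
have U : uniq [:: inl e.1; inr (e, s); inl e.2 : gT].
  rewrite /= !inE andbT /=; apply: contraTneq eE => -[e12].
  by rewrite [e]surjective_pairing e12 edge_irr.
have := acyc [:: _; _; _] isT U.
rewrite /mono /= !arc_glue /= eqs -eqe !eqxx eE sD.
by rewrite -surjective_pairing eE.
Qed.

(** Monochromatic arcs never decrease a suitable rank, and increase it except
    inside a block; so a monochromatic cycle lies inside one block, which the
    colourings h and h0 rule out.  Outside e0 an edge has ends of distinct
    colours, so a block vertex shares its colour with at most one end: it ranks
    4, above all vertices of the graph, or 0, below them.  At e0 one of the
    three steps of the circuit tail, block, head, tail has no monochromatic
    arc, so the other two can be ranked increasingly by 1, 2, 3. *)
Lemma glue_acyclic (H : digraph gT) (g : V -> nat) (h h0 : S -> nat) e0 :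
    subdigraph H glue -> e0 \in E ->
    (forall e, e \in E -> e != e0 -> g e.1 != g e.2) ->
    acyclic (mono D h) ->
    acyclic [rel s t | arc H (inr (e0, s)) (inr (e0, t)) && (h0 s == h0 t)] ->
    [\/ ~~ arc H (inl e0.2) (inl e0.1),
        forall s, arc H (inl e0.1) (inr (e0, s)) -> h0 s != g e0.1
      | forall s, arc H (inr (e0, s)) (inl e0.2) -> h0 s != g e0.2] ->
  acyclic (mono H (fun x => match x with
    | inl a => g a
    | inr (e, s) => if e == e0 then h0 s else h s
    end)).
Proof.
move=> [_ /subsetP sHD] e0E propE acD acH safe; set phi := (X in mono H X).
have sub x y : arc H x y -> glue_arc x y by move/sHD; rewrite inE.
have e012 : e0.1 != e0.2.
  apply: contraTneq e0E => e12; by rewrite [e0]surjective_pairing e12 edge_irr.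
(* ra, r, rb are the ranks of the tail, the block and the head of e0. *)
have [ra [r [rb [rng rba rar rrb]]]] : exists ra r rb,
  [/\ [&& 0 < ra < 4, 0 < r < 4 & 0 < rb < 4],
    arc H (inl e0.2) (inl e0.1) -> rb < ra,
    forall s, arc H (inl e0.1) (inr (e0, s)) -> g e0.1 == h0 s -> ra < r
  & forall s, arc H (inr (e0, s)) (inl e0.2) -> h0 s == g e0.2 -> r < rb].
  case: safe => [/negPf no|no|no].
  - by exists 1, 2, 3; split; rewrite ?no.
  - by exists 3, 1, 2; split=> // s /no; rewrite eq_sym => /negPf->.
  - by exists 2, 3, 1; split=> // s /no /negPf->.
pose rk (x : gT) := match x with
  | inl a => if a == e0.1 then ra else if a == e0.2 then rb else 2
  | inr (e, s) => if e == e0 then r else if h s == g e.1 then 4 else 0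
  end.
have rkl a : 0 < rk (inl a) < 4.
  by rewrite /rk; case: ifP => _; [|case: ifP => _]; case/and3P: rng.
have rk_lt x y : mono H phi x y ->
    rk x < rk y \/
    exists e s s', [/\ x = inr (e, s), y = inr (e, s') & rk x = rk y].
  rewrite /mono /= => /andP[xy]; have := sub _ _ xy.
  case: x y xy => [a|[e s]] [b|[e' s']] xy /=.
  - move=> baE; have [eq0|ne0] := eqVneq (b, a) e0.
      move=> _; left; move: xy; subst e0; move: e012 rba => /= ba rba.
      by rewrite !eqxx eq_sym (negPf ba) => /rba.
    by rewrite eq_sym => eqg; case/negP: (propE _ baE ne0).
  - case/and3P=> eE sD /eqP eqa; have [eq0|ne0] := eqVneq e' e0.
      by subst a e'; rewrite eqxx => eqg; left; apply: rar eqg.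
    rewrite eqa eq_sym => eqg; left; rewrite eqg; by case/andP: (rkl e'.1).
  - case/and3P=> eE sD /eqP eqb; have [eq0|ne0] := eqVneq e e0.
      subst b e; rewrite [e0.2 == _]eq_sym (negPf e012) eqxx => eqg.
      by left; apply: rrb eqg.
    rewrite eqb => /eqP eqg; rewrite eqg eq_sym (negPf (propE _ eE ne0)).
    by left; case/andP: (rkl e.2).
  - case/and3P=> _ /eqP<- _ eqg; right; exists e, s, s'; split=> //.
    by case: (e == e0) eqg => // /eqP->.
move=> c c0 Uc; apply/negP => cyc.
have rk_c : {in c &, forall x y, rk x <= rk y}.
  apply: cycle_homo cyc; first by move=> y x z; apply: leq_trans.
  by move=> x y /rk_lt[/ltnW//|[e [s [s' [_ _ ->]]]]].
have in_blocks : {in c &, forall x y, mono H phi x y ->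
    exists e s s', x = inr (e, s) /\ y = inr (e, s')}.
  move=> x y xc yc /rk_lt[|[e [s [s' [-> -> _]]]]]; last by exists e, s, s'.
  by rewrite ltnNge rk_c.
have [e all_e] : exists e, forall x, x \in c -> exists s, x = inr (e, s).
  pose blk (x : gT) := if x is inr (e, _) then Some e else None.
  have blk_c : {in c &, forall x y, (blk x != None) && (blk x == blk y)}.
    have cyc' : cycle (fun x y => (blk x != None) && (blk x == blk y)) c.
      apply: (sub_in_cycle (P := mem c) _ _ cyc); last by apply/allP.
      move=> x y xc yc xy; have [e [s [s' [-> ->]]]] := in_blocks x y xc yc xy.
      by rewrite /= eqxx.
    move: cyc'; apply: cycle_homo => // y x z /=.
    by case/andP=> -> /eqP-> /andP[_ /eqP->] /=.
  case: c c0 blk_c {Uc cyc rk_c in_blocks} => // x c _ blk_c.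
  have xc : x \in x :: c by rewrite inE eqxx.
  case blkx : (blk x) => [e|]; last by have := blk_c x x xc xc; rewrite blkx.
  exists e => y /(blk_c x y xc) /andP[_]; rewrite blkx => /eqP.
  by case: y => // -[e' s] /= [->]; exists s.
have [c' ec] : exists c', c = [seq inr (e, s) | s <- c'].
  elim: c all_e {c0 Uc cyc rk_c in_blocks} => [|x c IHc] all_e.
    by exists [::].
  have [|c' ->] := IHc; first by move=> y yc; apply: all_e; rewrite inE yc orbT.
  by have [|s ->] := all_e x; rewrite ?inE ?eqxx //; exists (s :: c').
move: c0 Uc cyc; rewrite ec map_inj_uniq; last by move=> ? ? [].
rewrite -size_eq0 size_map size_eq0 cycle_map => c0 Uc.
have [e_eq0|ne_e0] := eqVneq e e0.
  apply/negP; apply: contra (acH c' c0 Uc); apply: sub_cycle => s t.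
  by rewrite /mono /= e_eq0 eqxx.
apply/negP; apply: contra (acD c' c0 Uc); apply: sub_cycle => s t.
by rewrite /mono /= (negPf ne_e0) => /andP[/sub /= /and3P[_ _ ->]].
Qed.

(** Only the block of e0 is coloured specially, by a colouring h0 of a digraph
    D0 that may lack an arc of D; the other blocks copy a colouring of D. *)
Lemma glue_sub_dicolourable q (H : digraph gT) e0 (D0 : digraph S)
    (g : V -> nat) (h0 : S -> nat) :
    subdigraph H glue -> dicritical q.+1 D -> e0 \in E ->
    (forall a, 0 < g a <= q.+1) ->
    (forall e, e \in E -> e != e0 -> g e.1 != g e.2) ->
    verts D0 = verts D -> dicolouring D0 q.+1 h0 ->
    (forall s t, arc H (inr (e0, s)) (inr (e0, t)) -> arc D0 s t) ->
    [\/ ~~ arc H (inl e0.2) (inl e0.1),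
        forall s, arc H (inl e0.1) (inr (e0, s)) -> h0 s != g e0.1
      | forall s, arc H (inr (e0, s)) (inl e0.2) -> h0 s != g e0.2] ->
  dicolourable H q.+1.
Proof.
move=> subH /dicritical_dicolourable[h /dicolouringP[rngh ach]] e0E rngg propg.
move=> vD0 /dicolouringP[rng0 ac0] sub0 safe.
eexists; apply/dicolouringP; split; last first.
  apply: (glue_acyclic (g := g) (h := h) (h0 := h0) subH e0E propg ach _ safe).
  move=> c c0 Uc; apply: contra (ac0 c c0 Uc); apply: sub_cycle => s t.
  by rewrite /mono /= => /andP[/sub0-> ->].
have [/subsetP vH _] := subH.
case=> [a _|[e s] /vH] /=; first exact: rngg.
rewrite inE => /andP[_ sD]; case: ifP => _; last exact: rngh.
by apply: rng0; rewrite vD0.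
Qed.

(** The deleted arc decides how the block of its edge is coloured: arbitrarily,
    with the colour of the ends on one vertex only, or without that colour. *)
Theorem glue_dicritical q :
  critical_orientation E q.+1 -> dicritical q.+1 D -> dicritical q.+2 glue.
Proof.
move=> [_ coverE ncolE critE] critD.
have [e1 e1E] : exists e, e \in E.
  by have [e eE _] := ncolE (fun=> 1) (fun=> isT); exists e.
apply: (@dicritical_intro _ glue q.+1 (inl e1.1)); first by rewrite inE.
- case=> [a _|[e s]].
    have [b abE] := coverE a; exists (inl b).
    by rewrite !arc_glue /= orbC.
  rewrite inE => /andP[eE sD]; exists (inl e.1).
  by rewrite !arc_glue /= eE sD eqxx orbT.
- exact/glue_ndicolourable/dicritical_ndicolourable.
have col_h : exists h, dicolouring D q.+1 h by apply: dicritical_dicolourable.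
have subD f e s t : arc (del_arc glue f) (inr (e, s)) (inr (e, t)) -> arc D s t.
  by rewrite /arc /= !inE /= => /and4P[].
case=> x y; rewrite -[_ \in _]/(arc glue x y) arc_glue.
set f := (x, y) => xy; have subf : subdigraph (del_arc glue f) glue.
  by split; rewrite ?subsetDl.
case: x y @f xy subf => [b|[e s]] [a|[e' s']] f /=.
- move=> abE subf; have [g [rngg _ propg]] := critE _ abE.
  have [h colh] := col_h.
  apply: (glue_sub_dicolourable subf critD abE rngg propg (erefl _) colh).
    exact: subD.
  by apply: Or31; rewrite /arc /= !inE eqxx.
- case/and3P=> eE sD /eqP ? subf; subst.
  have [g [rngg eqg propg]] := critE _ eE.
  have [h [colh hs hns]] := dicritical_lonely_colouring critD sD (rngg e'.1).
  apply: (glue_sub_dicolourable subf critD eE rngg propg (erefl _) colh).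
    exact: subD.
  apply: Or32 => t; rewrite /arc /= !inE /= => /andP[ne _]; apply: hns.
  by apply: contraNneq ne => ->.
- case/and3P=> eE sD /eqP ? subf; subst.
  have [g [rngg eqg propg]] := critE _ eE.
  have [h [colh hs hns]] := dicritical_lonely_colouring critD sD (rngg e.2).
  apply: (glue_sub_dicolourable subf critD eE rngg propg (erefl _) colh).
    exact: subD.
  apply: Or33 => t; rewrite /arc /= !inE /= => /andP[ne _]; apply: hns.
  by apply: contraNneq ne => ->.
- case/and3P=> eE /eqP ee' st subf; subst e'.
  have [g [rngg eqg propg]] := critE _ eE.
  have colD := dicritical_proper critD (del_arc_proper st).
  have [h colh nh] := dicolouring_avoid colD (rngg e.1).
  apply: (glue_sub_dicolourable subf critD eE rngg propg _ colh) => //.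
    move=> t t'; rewrite /arc /= !inE /= => /and4P[ne _ _ tt'].
    apply/andP; split=> //.
    by apply: contraNneq ne => -[-> ->].
  by apply: Or32 => t _; apply: nh.
Qed.

End Gluing.

(** * Complete graphs and odd cycles *)

(** The edges, their reverses and the diagonal are disjoint sets of pairs. *)
Lemma card_asym (V : finType) (E : {set V * V}) :
  (forall a b, (a, b) \in E -> (b, a) \notin E) ->
  2 * #|E| + #|V| <= #|V| * #|V|.
Proof.
move=> asym; pose swap (e : V * V) := (e.2, e.1).
have swapK : involutive swap by case.
pose diag : {set V * V} := [set (a, a) | a : V].
have cd : #|diag| = #|V| by rewrite card_imset // => a b [].
have d1 : [disjoint E & swap @: E].
  apply/pred0P => -[a b] /=.
  apply/negP => /andP[abE /imsetP[[c d] cdE [ea eb]]].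
  by case/negP: (asym _ _ abE); rewrite ea eb.
have d2 : [disjoint E :|: swap @: E & diag].
  apply/pred0P => p /=; apply/negP => /andP[pE /imsetP[a _ pa]].
  have aaE : (a, a) \in E.
    move: pE; rewrite pa inE => /orP[//|/imsetP[[c d] cdE [ad ac]]].
    by rewrite {1}ac ad.
  by case/negP: (asym _ _ aaE).
rewrite -card_prod; apply: leq_trans (max_card [in (E :|: swap @: E) :|: diag]).
have cardU (A B : {set V * V}) : [disjoint A & B] -> #|A :|: B| = #|A| + #|B|.
  by move=> dAB; apply/eqP; rewrite (leq_card_setU A B).2.
by rewrite !cardU // cd card_imset ?mul2n ?addnn //; apply: inv_inj.
Qed.

Definition complete_edges k : {set 'I_k * 'I_k} :=
  [set e : 'I_k * 'I_k | e.1 < e.2].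

Lemma complete_critical q : critical_orientation (complete_edges q.+2) q.+1.
Proof.
split.
- by move=> a b; rewrite !inE /= -leqNgt => /ltnW.
- move=> a; case: (posnP a) => [a0|a_gt0].
    by exists ord_max; rewrite !inE /= a0.
  by exists ord0; rewrite !inE /= a_gt0 ?orbT.
- move=> g rng.
  have [/existsP[e /andP[eE /eqP]]|/existsPn no] :=
    boolP [exists e, (e \in complete_edges q.+2) && (g e.1 == g e.2)].
    by exists e.
  pose f (a : 'I_q.+2) : 'I_q.+1 := inord (g a).-1.
  have f_inj : injective f.
    move=> a b /(congr1 val); have ra := rng a; have rb := rng b.
    rewrite /f /= !inordK; [|lia|lia] => gab; apply/val_inj => /=.
    have eqg : g a = g b by lia.
    have := no (a, b); have := no (b, a); rewrite !inE /= eqg eqxx !andbT.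
    lia.
  by have := leq_card f f_inj; rewrite !card_ord ltnn.
- move=> [a0 b0]; rewrite inE /= => ab0.
  (* All colours differ except that b0 takes the colour of a0; [unbump b0]
     closes the gap left by b0. *)
  exists (fun i => (unbump b0 (if i == b0 then a0 : nat else i)).+1); split.
  + move=> i; rewrite /= /unbump; have := ltn_ord i; have := ltn_ord b0.
    by case: eqP => [->|/eqP]; rewrite -?val_eqE /=; lia.
  + by rewrite /= eqxx -val_eqE (ltn_eqF ab0).
  + case=> i j; rewrite inE /= xpair_eqE -!val_eqE /= /unbump.
    by case: (eqVneq (i : nat) b0); case: (eqVneq (j : nat) b0) => /=; lia.
Qed.

(** The length is 2m + 3, as the cycle of length 1 would be a loop. *)
Definition odd_cycle_edges m : {set 'I_m.*2.+3 * 'I_m.*2.+3} :=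
  [set e : 'I_m.*2.+3 * 'I_m.*2.+3 |
    (e.2 == e.1.+1 :> nat) || (e.1 == m.*2.+2 :> nat) && (e.2 == 0 :> nat)].

Lemma odd_cycle_critical m : critical_orientation (odd_cycle_edges m) 2.
Proof.
split.
- move=> a b; rewrite !inE /=; lia.
- move=> a; have := ltn_ord a; rewrite ltnS leq_eqVlt => /orP[/eqP eqa|lta].
  + by exists ord0; rewrite !inE /= eqa eqxx ?orbT.
  + by exists (inord a.+1); rewrite !inE /= inordK ?eqxx.
- move=> g rng.
  have [/existsP[e /andP[eE /eqP]]|/existsPn no] :=
    boolP [exists e, (e \in odd_cycle_edges m) && (g e.1 == g e.2)].
    by exists e.
  have ne a b : (a, b) \in odd_cycle_edges m -> odd (g b) = ~~ odd (g a).
    move=> abE; have := no (a, b); rewrite abE /=.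
    move: (g a) (g b) (rng a) (rng b).
    by move=> [|[|[|x]]] [|[|[|y]]].
  (* The parity of the colour alternates along the path 0, 1, 2, ..., whose
     last vertex has an even number and is adjacent to 0. *)
  have alt i : i < m.*2.+3 -> odd (g (inord i)) = odd (g ord0) (+) odd i.
    elim: i => [_|i IHi lti] /=.
      by rewrite addbF; congr (odd (g _)); apply: val_inj; rewrite /= inordK.
    rewrite (ne (inord i)) ?IHi ?addbN ?(ltnW lti) //.
    by rewrite inE /= !inordK ?eqxx // ltnW.
  have := ne (inord m.*2.+2) ord0.
  rewrite alt // inE /= inordK // odd_double eqxx addbF ?orbT => /(_ isT).
  by case: (odd _).
- move=> [a0 b0]; rewrite inE /= => abE.
  (* Alternate, with a shift of parity just after the deleted edge.  If that
     edge is the one from the last vertex to 0, no shift is wanted. *)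
  pose g (i : 'I_m.*2.+3) := odd i (+) ((b0 != 0 :> nat) && (a0 < i)).
  exists (fun i => (g i).+1); rewrite {}/g; split.
  + by move=> i; case: (_ (+) _).
  + rewrite /= ltnn andbF addbF.
    case/orP: abE => [/eqP->|/andP[/eqP-> /eqP->]] /=.
      by rewrite ltnSn addbT negbK.
    by rewrite odd_double.
  + case=> i j; rewrite inE /= xpair_eqE -!val_eqE /= eqSS => ijE.
    have ltb := ltn_ord b0.
    case/orP: abE => [/eqP eb|/andP[/eqP ea /eqP eb]].
      rewrite eb /=; case/orP: ijE => [/eqP->|/andP[/eqP-> /eqP->]] /=.
        rewrite eqSS andbb eq_sym => ne.
        rewrite ltnS [a0 <= i]leq_eqVlt (negPf ne) /=.
        by case: (odd i); case: (a0 < i).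
      have -> : a0 < m.*2.+2 by rewrite -ltnS -eb.
      by rewrite odd_double.
    rewrite ea eb /=; case/orP: ijE => [/eqP->|/andP[/eqP-> /eqP->]] /=.
      by rewrite !addbF; case: (odd i).
    by rewrite !eqxx.
Qed.

Lemma card_odd_cycle_edges m : #|odd_cycle_edges m| <= m.*2.+3.
Proof.
have inj : {in odd_cycle_edges m &, injective fst}.
  move=> [a b] [a' b']; rewrite !inE /= => h h' eqa; subst a'.
  congr (_, _); apply: val_inj => /=.
  have := ltn_ord b; have := ltn_ord b'; lia.
by rewrite -(card_in_imset inj) -[X in _ <= X]card_ord max_card.
Qed.

(** * Sparse dicritical oriented graphs *)

Fact point_wf : set0 \subset
  [set a : unit * unit |
    [&& a.1 \in [set: unit], a.2 \in [set: unit] & a.1 != a.2]].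
Proof. exact: sub0set. Qed.

Definition point := Digraph point_wf.

Lemma point_dicritical : dicritical 1 point.
Proof.
have no_arc (H : digraph unit) phi :
    subdigraph H point -> acyclic (mono H phi).
  move=> [_ /subsetP sub]; apply: acyclic_eq0 => x y.
  by apply/negP => /andP[/sub]; rewrite inE.
have col0 (H : digraph unit) k : subdigraph H point ->
    (forall v, v \in verts H -> 0 < k) -> dicolourable H k.
  move=> sub k0; exists (fun=> 1); apply/dicolouringP; split=> [v /k0//|].
  exact: no_arc.
split.
  apply/eqP; rewrite eqn_leq; apply/andP; split.
    by apply/dichromatic_leP/col0.
  rewrite ltnNge; apply/negP => /dichromatic_leP[phi [/(_ tt)]].
  by rewrite inE => /(_ isT); lia.
move=> H [sub neH]; rewrite ltnS; apply/dichromatic_leP/col0 => // v vH.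
case: neH; apply: digraph_eq.
  by apply/setP => -[]; rewrite inE; case: v vH => ->.
by apply/eqP; rewrite -subset0; case: sub.
Qed.

(** A point glued along a single edge, the complete graph on two vertices, is
    a directed triangle. *)
Lemma triangle_exists : exists (S : finType) (D : digraph S),
  [/\ dicritical 2 D, oriented D, #|verts D| = 3 & #|arcs D| <= 3].
Proof.
have Ec := complete_critical 0.
exists _, (glue point (edge_asym Ec)); split.
- exact: glue_dicritical point_dicritical.
- by apply: glue_oriented => u v; rewrite /arc /= !inE.
- have [e eE _] := edge_ncol Ec (fun=> isT : 0 < 1 <= 1).
  have := card_asym (edge_asym Ec).
  rewrite card_glue_verts /= cardsT card_unit card_ord.
  have : 0 < #|complete_edges 2| by apply/card_gt0P; exists e.
  by set c := #|_|; lia.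
- have := card_asym (edge_asym Ec); have := card_glue_arcs point (edge_asym Ec).
  by rewrite /= cards0 cardsT card_unit card_ord; lia.
Qed.

(** The bound on the number of arcs, multiplied by 2 to stay in nat. *)
Definition sparse_critical k : Prop :=
  forall N, exists (T : finType) (D : digraph T),
    [/\ dicritical k D, oriented D, N < #|verts D|
      & 2 * #|arcs D| + 7 * #|verts D| <= 4 * k * #|verts D|].

(** With l = 2N + 3 there are 4l vertices and at most 10l arcs. *)
Lemma sparse_critical3 : sparse_critical 3.
Proof.
move=> N; have [S [D [critD orD nD mD]]] := triangle_exists.
have Ec := odd_cycle_critical N.
exists _, (glue D (edge_asym Ec)); split.
- exact: glue_dicritical critD.
- exact: glue_oriented.
- by rewrite card_glue_verts card_ord; lia.
- have := card_glue_arcs D (edge_asym Ec); have := card_odd_cycle_edges N.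
  rewrite card_glue_verts card_ord nD.
  set c := #|odd_cycle_edges N|; set d := #|arcs D| in mD *.
  by set n := #|arcs _|; nia.
Qed.

(** Let k = q + 2, let D have n vertices, and let the complete graph on k
    vertices have e edges.  Twice the arcs number at most
    e (2 + 4n + (4k - 11) n) = 2e + (4k - 7) e n, so what must be checked is
    2e <= (4k - 7) k, and 2e <= k^2 suffices as 3 <= k. *)
Lemma sparse_criticalS q :
  2 <= q -> sparse_critical q.+1 -> sparse_critical q.+2.
Proof.
move=> q2 IH N; have [S [D [critD orD nD mD]]] := IH N.
have Ec := complete_critical q.
exists _, (glue D (edge_asym Ec)); split.
- exact: glue_dicritical critD.
- exact: glue_oriented.
- have [e eE _] := edge_ncol Ec (fun=> isT : 0 < 1 <= q.+1).
  have : 0 < #|complete_edges q.+2| by apply/card_gt0P; exists e.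
  by rewrite card_glue_verts card_ord; set c := #|complete_edges _|; nia.
- have := card_glue_arcs D (edge_asym Ec); have := card_asym (edge_asym Ec).
  rewrite card_glue_verts card_ord.
  set c := #|complete_edges _|; set d := #|arcs D| in mD *.
  by set n := #|arcs _|; nia.
Qed.

Local Open Scope ring_scope.

Theorem proposition26 (k : nat) (hk : (3 <= k)%N) :
  forall N : nat, exists n : nat, (N < n)%N /\
    exists (T : finType) (D : digraph T),
      [/\ dicritical k D,
          oriented D,
          #|verts D| = n
        & #|arcs D|%:R <= (2%:R * k%:R - 7%:R / 2%:R) * n%:R :> rat].
Proof.
have sparse : sparse_critical k.
  elim: k hk => // k IHk; rewrite leq_eqVlt => /orP[/eqP<-|k3].
    exact: sparse_critical3.
  by case: k k3 IHk => // k k3 IHk; apply: sparse_criticalS => //; apply: IHk.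
move=> N; have [T [D [critD orD nD mD]]] := sparse N.
exists #|verts D|; split=> //; exists T, D; split=> //.
move: mD; rewrite -(ler_nat rat) !natrD !natrM; lra.
Qed.
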